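(* Let $\mathfrak{g}$ be a finite-dimensional Lie algebra over a field $K$ containing an abelian ideal of codimension one. Then $\mathrm{AID}(\mathfrak{g})=\mathrm{Inn}(\mathfrak{g})$.
   Context: For a finite-dimensional Lie algebra $\mathfrak{g}$ over a field $K$, let $\mathrm{Der}(\mathfrak{g})$ be its Lie algebra of derivations and $\mathrm{Inn}(\mathfrak{g})=\{\mathrm{ad}(x)\mid x\in\mathfrak{g}\}$ the inner derivations. A derivation $D\in\mathrm{Der}(\mathfrak{g})$ is called almost inner if $D(x)\in[\mathfrak{g},x]=\{[y,x]\mid y\in\mathfrak{g}\}$ for all $x\in\mathfrak{g}$. The space of almost inner derivations is denoted $\mathrm{AID}(\mathfrak{g})$. *)

(* Defs.v *)
From HB Require Import structures.
From mathcomp Require Import all_boot all_order all_algebra.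
From mathcomp Require Import boolp classical_sets.
Set Implicit Arguments.
Unset Strict Implicit.
Unset Printing Implicit Defensive.
Import GRing.Theory.
Local Open Scope ring_scope.
Local Open Scope classical_set_scope.

(* The bracket is required to be alternating, not merely antisymmetric, so
   that the definition is the right one in characteristic 2 as well. *)
HB.mixin Record Vector_isLie (K : fieldType) (L : Type) of Vector K L := {
  lie : L -> L -> L;
  lie_linearl : forall (a : K) (x y z : L),
    lie (a *: x + y) z = a *: lie x z + lie y z;
  lie_linearr : forall (a : K) (x y z : L),
    lie x (a *: y + z) = a *: lie x y + lie x z;
  lie_alt : forall x : L, lie x x = 0;
  lie_jacobi : forall x y z : L,
    lie x (lie y z) + lie y (lie z x) + lie z (lie x y) = 0
}.

(* Since vectType is a structure of finite-dimensional spaces, these are the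
   finite-dimensional Lie algebras over K. *)
#[short(type="lieAlgType")]
HB.structure Definition LieAlgebra (K : fieldType) :=
  {L of Vector_isLie K L & Vector K L}.

HB.instance Definition _ (K : fieldType) (g : lieAlgType K) (x : g) :=
  GRing.isLinear.Build K g g *:%R (lie x) (fun a => @lie_linearr K g a x).

Section LieAlgebraDefs.
Variables (K : fieldType) (g : lieAlgType K).

Definition ideal (A : {vspace g}) : Prop :=
  forall x y : g, y \in A -> lie x y \in A.

Definition abelian_sub (A : {vspace g}) : Prop :=
  forall x y : g, x \in A -> y \in A -> lie x y = 0.

Definition ad (x : g) : 'End(g) := linfun (lie x).

Lemma adE (x y : g) : ad x y = lie x y.
Proof. by rewrite lfunE. Qed.

Definition Der : set 'End(g) :=
  [set D : 'End(g) | forall x y : g, D (lie x y) = lie (D x) y + lie x (D y)].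

Definition Inn : set 'End(g) := [set ad x | x in [set: g]].

Definition AID : set 'End(g) :=
  [set D : 'End(g) | Der D /\
     forall x : g, [set lie y x | y in [set: g]] (D x)].

End LieAlgebraDefs.

Arguments Der {K} g.
Arguments Inn {K} g.
Arguments AID {K} g.

(* Main.v *)
Require Import Defs.
From HB Require Import structures.
From mathcomp Require Import all_boot all_order all_algebra.
From mathcomp Require Import boolp classical_sets.

(** Let [e] span a complement of the abelian ideal [A], and let [D] be almost
    inner.  Since [D e] is [lie y e] for some [y], the almost inner map
    [D - ad y] kills [e], so it suffices to treat a [D] with [D e = 0].  For
    [x] in [A], write the witness of almost innerness at [x] as an element of
    [A] plus [c *: e]; as [A] is abelian only the second part contributes, and
    [D x = c *: lie e x], where the scalar [c] may depend on [x].  Linearity of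
    [D] and [ad e] forces one scalar to serve the whole of [A]
    ([pointwise_proportional_uniform]): the point is that [D] factors
    through [ad e] on [A], by a linear map of which every nonzero vector of the image
    is an eigenvector, that is, by a scalar [l].  As [D] and [l *: ad e] also
    agree at [e], where both vanish, [D = ad (l *: e)].  In the other direction,
    inner maps are derivations by the Jacobi identity. *)

Set Implicit Arguments.
Unset Strict Implicit.
Unset Printing Implicit Defensive.
Import GRing.Theory.
Local Open Scope ring_scope.
Local Open Scope classical_set_scope.

(** If [S x] is always a multiple of [T x], the kernel of [T] lies in that of
    [S], and two independent values of [T] must carry the same ratio because
    their sum carries a ratio too. *)
Lemma pointwise_proportional_uniform (K : fieldType) (V W : vectType K)
    (U : {vspace V}) (S T : 'Hom(V, W)) :
  (forall x, x \in U -> exists c : K, S x = c *: T x) ->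
  exists l : K, forall x, x \in U -> S x = l *: T x.
Proof.
move=> ST.
have [[x0 [Ux0 Tx0]]|T0] := pselect (exists x, x \in U /\ T x != 0); last first.
  exists 0 => x Ux; have [c ->] := ST x Ux.
  suff -> : T x = 0 by rewrite !scaler0.
  by apply/eqP/negPn/negP => Tx; apply: T0; exists x.
have [l Sx0] := ST x0 Ux0; exists l => x Ux.
have [/vlineP[m Tx]|Tx_free] := boolP (T x \in <[T x0]>%VS).
  (* [x - m *: x0] is in the kernel of [T], hence in that of [S]. *)
  have Uy : x - m *: x0 \in U by rewrite rpredB // rpredZ.
  have [c] := ST _ Uy.
  rewrite (linearB S) (linearB T) !linearZ /= !scalerN Tx subrr scaler0 Sx0.
  by move/eqP; rewrite subr_eq0 => /eqP ->; rewrite !scalerA mulrC.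
have [c Sx] := ST x Ux.
have [c'] := ST _ (rpredD Ux Ux0); rewrite (linearD S) (linearD T) /= Sx Sx0 => sumE.
have ratioE : (c - c') *: T x = (c' - l) *: T x0.
  apply/eqP; rewrite !scalerBl subr_eq addrAC eq_sym subr_eq -scalerDr.
  by rewrite [T x0 + _]addrC sumE.
have cc' : c = c'.
  apply/eqP; rewrite -subr_eq0; apply: contraR Tx_free => nz.
  by rewrite -[T x](scalerK nz) ratioE scalerA memvZ // memv_line.
move/eqP: ratioE; rewrite cc' subrr scale0r eq_sym scaler_eq0 (negPf Tx0) orbF.
by rewrite subr_eq0 => /eqP ->.
Qed.

Lemma codim1_complement_line (K : fieldType) (V : vectType K)
    (A : {vspace V}) :
  \dim {:V} = (\dim A).+1 -> exists e : V, (A + <[e]> = fullv)%VS.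
Proof.
move=> dimA; have dimC : \dim (A^C)%VS = 1%N.
  by rewrite dimv_compl dimA subSnn.
exists (vpick (A^C)%VS); suff -> : (<[vpick A^C]> = A^C)%VS by exact: addv_complf.
apply/eqP; rewrite eqEdim -memvE memv_pick dim_vline dimC vpick0.
by rewrite -dimv_eq0 dimC.
Qed.

Section LieBracket.
Variables (K : fieldType) (g : lieAlgType K).
Implicit Types (x y z : g) (D : 'End(g)).

Lemma lieDl x y z : lie (x + y) z = lie x z + lie y z.
Proof. by rewrite -[x in LHS]scale1r lie_linearl scale1r. Qed.

Lemma lie0l z : lie 0 z = 0.
Proof. by apply: (addrI (lie 0 z)); rewrite -lieDl !addr0. Qed.

Lemma lieZl (a : K) x z : lie (a *: x) z = a *: lie x z.
Proof. by rewrite -[a *: x]addr0 lie_linearl lie0l addr0. Qed.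

Lemma lieC x y : lie x y = - lie y x.
Proof.
apply/eqP; rewrite -addr_eq0; apply/eqP.
have := lie_alt (x + y); rewrite lieDl !linearD /= !lie_alt.
by rewrite add0r addr0.
Qed.

Lemma adD x y : ad (x + y) = ad x + ad y.
Proof. by apply/lfunP => z; rewrite add_lfunE !adE lieDl. Qed.

Lemma adZ (a : K) x : ad (a *: x) = a *: ad x.
Proof. by apply/lfunP => z; rewrite scale_lfunE !adE lieZl. Qed.

Lemma ad_Der x : Der g (ad x).
Proof.
move=> y z; rewrite !adE; have /eqP := lie_jacobi x y z.
rewrite -addrA addr_eq0 => /eqP ->.
by rewrite opprD addrC (lieC z) opprK (lieC z x) linearN opprK.
Qed.

Lemma Inn_sub_AID : Inn g `<=` AID g.
Proof.
move=> _ [x _ <-]; split; first exact: ad_Der.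
by move=> y; exists x; rewrite ?adE.
Qed.

End LieBracket.

Theorem theorem3p1 (K : fieldType) (g : lieAlgType K) (A : {vspace g})
  (A_ideal : ideal A) (A_abelian : abelian_sub A)
  (A_codim1 : \dim {:g} = (\dim A).+1) :
  AID g = Inn g.
Proof.
apply/seteqP; split; last exact: Inn_sub_AID.
move=> D [_ D_ai].
have [e Ae_full] := codim1_complement_line A_codim1.
have decomp (z : g) : exists2 a, a \in A & exists c : K, z = a + c *: e.
  have /memv_addP[a Aa [_ /vlineP[c ->] ->]] : z \in (A + <[e]>)%VS.
    by rewrite Ae_full memvf.
  by exists a => //; exists c.
have [y _ De] := D_ai e.
have D_prop x : x \in A -> exists c : K, (D - ad y) x = c *: ad e x.
  move=> Ax; have [w _ Dx] := D_ai x.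
  have [a Aa [c wyE]] := decomp (w - y); exists c.
  rewrite add_lfunE opp_lfunE !adE -Dx -[in LHS](subrK y w) wyE !lieDl lieZl.
  by rewrite addrK A_abelian // add0r.
have [l Dl] := pointwise_proportional_uniform D_prop.
exists (y + l *: e) => //; apply/lfunP => z.
have [a Aa [c ->]] := decomp z.
rewrite adD adZ !linearD !linearZ /= -De; congr (_ + _).
  by rewrite add_lfunE scale_lfunE -Dl // !add_lfunE opp_lfunE addrC subrK.
by rewrite add_lfunE scale_lfunE !adE lie_alt scaler0 addr0.
Qed.
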